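(* Let $G$ be a connected $(P_5,K_3\cup K_1)$-free graph. Then $cop(G)\leq 2$.
   Context: All graphs are finite, simple and undirected. $P_n$ and $K_n$ denote the path and complete graph on $n$ vertices; $G\cup H$ denotes the disjoint union of vertex-disjoint graphs, so $K_3\cup K_1$ is a triangle plus an isolated vertex. A graph is $(H_1,\dots,H_k)$-free if it contains no induced subgraph isomorphic to any $H_i$. Game of cops and robber on a connected graph: first all cops are placed on vertices (several may share a vertex), then the robber chooses a vertex; afterwards cops and robber move alternately, starting with the cops, a move consisting of staying put or moving to an adjacent vertex. The cops win if after finitely many rounds some cop is on the same vertex as the robber. The cop number $cop(G)$ is the minimum number of cops that guarantees a win in each connected component of $G$. *)

(* Defs.v *)
#[warnings="-notation-overridden"]
From mathcomp Require Import all_boot.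
From mathcomp Require Import boolp.

Set Implicit Arguments.
Unset Strict Implicit.
Unset Printing Implicit Defensive.

Record sgraph := SGraph {
  vertex :> finType;
  adj : rel vertex;
  adj_sym : symmetric adj;
  adj_irrefl : irreflexive adj
}.
Arguments adj {s}.

Section Constructions.

Definition path_adj n : rel 'I_n := [rel i j : 'I_n | (i.+1 == j) || (j.+1 == i)].

Fact path_adj_sym n : symmetric (@path_adj n).
Proof. by move=> i j; rewrite /path_adj /= orbC. Qed.

Fact path_adj_irrefl n : irreflexive (@path_adj n).
Proof. by move=> i; rewrite /path_adj /= gtn_eqF. Qed.

Definition path_graph n := SGraph (@path_adj_sym n) (@path_adj_irrefl n).

Definition complete_adj n : rel 'I_n := [rel i j | i != j].

Fact complete_adj_sym n : symmetric (@complete_adj n).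
Proof. by move=> i j; rewrite /complete_adj /= eq_sym. Qed.

Fact complete_adj_irrefl n : irreflexive (@complete_adj n).
Proof. by move=> i; rewrite /complete_adj /= eqxx. Qed.

Definition complete_graph n :=
  SGraph (@complete_adj_sym n) (@complete_adj_irrefl n).

Variables G H : sgraph.

Definition union_adj : rel (G + H)%type := fun u v =>
  match u, v with
  | inl x, inl y => adj x y
  | inr x, inr y => adj x y
  | _, _ => false
  end.

Fact union_adj_sym : symmetric union_adj.
Proof. by move=> [x|x] [y|y] //=; rewrite adj_sym. Qed.

Fact union_adj_irrefl : irreflexive union_adj.
Proof. by move=> [x|x] /=; rewrite adj_irrefl. Qed.

Definition union_graph := SGraph union_adj_sym union_adj_irrefl.

Variable S : {set G}.

Definition induced_adj : rel {x : G | x \in S} :=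
  [rel u v | adj (val u) (val v)].

Fact induced_adj_sym : symmetric induced_adj.
Proof. by move=> u v; rewrite /induced_adj /= adj_sym. Qed.

Fact induced_adj_irrefl : irreflexive induced_adj.
Proof. by move=> u; rewrite /induced_adj /= adj_irrefl. Qed.

Definition induced_subgraph := SGraph induced_adj_sym induced_adj_irrefl.

End Constructions.

Definition isomorphic (G H : sgraph) : Prop :=
  exists2 f : G -> H, bijective f & forall x y, adj (f x) (f y) = adj x y.

Definition graph_free (H G : sgraph) : Prop :=
  forall S : {set G}, ~ isomorphic (induced_subgraph S) H.

Definition graph_connected (G : sgraph) : Prop :=
  forall x y : G, connect adj x y.

Definition component (G : sgraph) (x : G) : sgraph :=
  induced_subgraph [set y | connect adj x y].

Section Game.

Variables (k : nat) (G : sgraph).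

Definition step (x y : G) : bool := (x == y) || adj x y.

(* A strategy gives the positions of the k cops as a function of the sequence
   of all robber positions so far, oldest first; its value at [::] is the
   initial placement. The cops' own past positions are determined by the
   strategy, so they need not be part of the history. *)
Definition cop_strategy := seq G -> 'I_k -> G.

Definition legal_strategy (s : cop_strategy) : Prop :=
  forall h x i, step (s h i) (s (rcons h x) i).

Definition robber_play (r : nat -> G) : Prop := forall n, step (r n) (r n.+1).

(* The play alternates as follows:
     s [::], r 0, s [:: r 0], r 1, s [:: r 0; r 1], r 2, ...
   The disjuncts are the positions right after the robber has come to r n and
   right after the cops' reply to it. *)
Definition caught (s : cop_strategy) (r : nat -> G) : Prop :=
  exists n i, s (mkseq r n) i = r n \/ s (mkseq r n.+1) i = r n.

Definition cops_win : Prop :=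
  exists2 s, legal_strategy s & forall r, robber_play r -> caught s r.

End Game.

Definition cops_suffice (G : sgraph) (k : nat) : Prop :=
  forall x : G, cops_win k (component x).

Fact cops_suffice_card (G : sgraph) : cops_suffice G #|G|.
Proof.
move=> x.
have x0P : x \in [set y | connect adj x y] by rewrite inE connect0.
pose x0 : component x := Sub x x0P.
exists (fun _ i => nth x0 (enum (component x)) i).
  by move=> h y i; rewrite /step eqxx.
move=> r _; exists 0.
have lt_i : index (r 0) (enum (component x)) < #|G|.
  have le_c : #|component x| <= #|G| by apply: (leq_card _ val_inj).
  by apply: leq_trans le_c; rewrite cardE index_mem mem_enum.
by exists (Ordinal lt_i); left; rewrite nth_index ?mem_enum.
Qed.

Fact ex_cops_suffice (G : sgraph) : exists k, `[< cops_suffice G k >].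
Proof. by exists #|G|; apply/asboolP; exact: cops_suffice_card. Qed.

Definition cop_number (G : sgraph) : nat := ex_minn (ex_cops_suffice G).

(* Main.v *)
Require Import Defs.
#[warnings="-notation-overridden"]
From mathcomp Require Import all_boot.
From mathcomp Require Import boolp.

(** Let [uv] be an edge dominating as many vertices as possible. A private
neighbour [a] of [u] and a private neighbour [b] of [v] that are non-adjacent
have the same undominated neighbours, since otherwise [a u v b d] is an induced
[P_5]; likewise non-adjacent private neighbours of [u] have comparable sets of
undominated neighbours. A robber on an undominated vertex [d] is attacked by
moving the cop on [u] to a private neighbour [a] of [u], chosen extremal among
those adjacent to [d]. The robber must flee to another private neighbour of
[u], after which the cop on [v] moves to [u] and the robber is caught, except
in an explicit obstructing configuration. If the obstruction occurs for both
[u] and [v], it yields an edge [a' b'] dominating everything but some common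
neighbours of [u] and [v], and the cops win from [a'] and [b']. *)

Set Implicit Arguments.
Unset Strict Implicit.
Unset Printing Implicit Defensive.

(** * The two-cop game with a bounded number of rounds *)

Section TwoCops.

Variable G : sgraph.

(** The cops are to move and can capture within [n.+1] of their moves: an immediate capture already
    counts at [n = 0]. *)
Fixpoint win n (c1 c2 r : G) : bool :=
  [|| step c1 r, step c2 r |
    if n is m.+1 then
      [exists c : G * G, [&& step c1 c.1, step c2 c.2 &
        [forall r', step r r' ==> win m c.1 c.2 r']]]
    else false].

Lemma win_capture n c1 c2 r : step c1 r || step c2 r -> win n c1 c2 r.
Proof. by case: n => [|n] /=; rewrite orbA => ->. Qed.

Lemma win_move n c1 c2 r c1' c2' :
    step c1 c1' -> step c2 c2' ->
    (forall r', step r r' -> win n c1' c2' r') ->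
  win n.+1 c1 c2 r.
Proof.
move=> s1 s2 w /=; apply/or3P; apply: Or33; apply/existsP; exists (c1', c2').
by rewrite s1 s2 /=; apply/forallP=> r'; apply/implyP; exact: w.
Qed.

Lemma winC n c1 c2 r : win n c1 c2 r = win n c2 c1 r.
Proof.
suff imp x y z : win n x y z -> win n y x z by apply/idP/idP; exact: imp.
elim: n x y z => [|n IHn] x y z; first by rewrite /= orbCA.
case/or3P=> [s|s|/existsP[[a b] /and3P[sa sb /forallP w]]].
- by apply: win_capture; rewrite s orbT.
- by apply: win_capture; rewrite s.
- by apply: win_move sb sa _ => r' s; apply: IHn; have /implyP := w r'; apply.
Qed.

(** Staying put as the default keeps the strategy legal at positions that are not won. *)
Definition reply n (c : G * G) r : G * G :=
  if step c.1 r then (r, c.2) else if step c.2 r then (c.1, r) else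
  if n is m.+1 then
    odflt c [pick c' : G * G | [&& step c.1 c'.1, step c.2 c'.2 &
      [forall r', step r r' ==> win m c'.1 c'.2 r']]]
  else c.

Definition next (s : nat * (G * G)) r := (s.1.-1, reply s.1 s.2 r).

Lemma stepxx (x : G) : step x x. Proof. by rewrite /step eqxx. Qed.

Lemma reply_step n c r : step c.1 (reply n c r).1 && step c.2 (reply n c r).2.
Proof.
rewrite /reply; case: ifP => [s|_]; first by rewrite s stepxx.
case: ifP => [s|_]; first by rewrite s stepxx.
case: n => [|n]; first by rewrite !stepxx.
by case: pickP => [c' /and3P[-> ->]|_] //=; rewrite !stepxx.
Qed.

(** The strategy folds [next] over the robber's history, so its state is the remaining number of
    rounds and the two cop positions. Until capture, [win] is invariant while the counter
    decreases. *)
Lemma cops_win_of_win N c1 c2 : (forall r, win N c1 c2 r) -> cops_win 2 G.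
Proof.
move=> winN; pose st := foldl next (N, (c1, c2)).
exists (fun h (i : 'I_2) => if i == ord0 then (st h).2.1 else (st h).2.2).
  move=> h x i; rewrite /st foldl_rcons -/(st h) /=.
  by have /andP[] := reply_step (st h).1 (st h).2 x; case: ifP.
move=> r rP; have: win (st (mkseq r 0)).1 (st (mkseq r 0)).2.1
   (st (mkseq r 0)).2.2 (r 0) by exact: winN.
have stS t : st (mkseq r t.+1) = next (st (mkseq r t)) (r t).
  by rewrite mkseqS /st foldl_rcons.
suff IH n t : (st (mkseq r t)).1 = n ->
    win n (st (mkseq r t)).2.1 (st (mkseq r t)).2.2 (r t) ->
    exists t, exists i : 'I_2,
      (if i == ord0 then (st (mkseq r t)).2.1 else (st (mkseq r t)).2.2) = r t \/
      (if i == ord0 then (st (mkseq r t.+1)).2.1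
       else (st (mkseq r t.+1)).2.2) = r t by exact: IH.
elim: n t => [|n IHn] t; case E: (st _) => [m [x y]] /= Em.
  rewrite orbF => w; exists t.
  have := stS t; rewrite E /next /= /reply /=; case: ifP w => [_ _|_ /= ->] ->.
    by exists ord0; right.
  by exists ord_max; right.
have := stS t; rewrite E /next Em /= /reply /=.
case: ifP => [_ F _|_]; first by exists t, ord0; right; rewrite F.
case: ifP => [_ F _|_ F]; first by exists t, ord_max; right; rewrite F.
case/existsP=> c /and3P[s1 s2 s3].
case: pickP F => [[a b] /and3P[_ _ /forallP w] F|/(_ c)]; last by rewrite s1 s2 s3.
apply: (IHn t.+1); first by rewrite F.
by rewrite F /=; have /implyP := w (r t.+1); apply; exact: rP.
Qed.

End TwoCops.


Ltac adj_done := solve [done | by rewrite adj_sym].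

(** * Domination by an edge under the two forbidden subgraphs *)

Section Domination.

Variable G : sgraph.

Hypothesis no_P5 : forall p q r s t : G,
  adj p q -> adj q r -> adj r s -> adj s t ->
  ~~ adj p r -> ~~ adj p s -> ~~ adj p t -> ~~ adj q s -> ~~ adj q t ->
  ~~ adj r t -> False.

Hypothesis no_K3K1 : forall p q r s : G,
  adj p q -> adj q r -> adj p r -> ~~ adj p s -> ~~ adj q s -> ~~ adj r s ->
  False.

Definition undominated (u v d : G) := ~~ adj u d && ~~ adj v d.

Definition private (u v a : G) := adj u a && ~~ adj v a.

Lemma undominatedC u v d : undominated u v d = undominated v u d.
Proof. exact: andbC. Qed.

Section Edge.

Variables u v : G.
Hypothesis uv : adj u v.

(** Otherwise either the triangle [a d e] misses [v], or [v u a d e] is an induced path. *)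
Lemma private_undominated_isolated a d e :
    private u v a -> undominated u v d -> undominated u v e -> adj a d ->
  ~~ adj d e.
Proof.
move=> /andP[ua va] /andP[ud vd] /andP[ue ve] ad; apply/negP=> de.
have [ae|ae] := boolP (adj a e).
  by apply: (@no_K3K1 a d e v); adj_done.
by apply: (@no_P5 v u a d e); adj_done.
Qed.

Lemma private_nonadj_sub a b d :
    private u v a -> private v u b -> ~~ adj a b -> undominated u v d ->
  adj b d -> adj a d.
Proof.
move=> /andP[ua va] /andP[vb ub] ab /andP[ud vd] bd.
apply: contraT => ad; exfalso; by apply: (@no_P5 a u v b d); adj_done.
Qed.

(** Otherwise [d1 a1 u a2 d2] is an induced path. *)
Lemma private_chain a1 a2 d1 d2 :
    private u v a1 -> private u v a2 -> ~~ adj a1 a2 ->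
    undominated u v d1 -> undominated u v d2 ->
  adj a1 d1 -> ~~ adj a2 d1 -> adj a2 d2 -> adj a1 d2.
Proof.
move=> A1 A2 a12 J1 J2 ad1 ad21 ad2; apply: contraT => ad12; exfalso.
have d12 := private_undominated_isolated A1 J1 J2 ad1.
case/andP: A1 A2 J1 J2 => ua1 _ /andP[ua2 _] /andP[ud1 _] /andP[ud2 _].
by apply: (@no_P5 d1 a1 u a2 d2); adj_done.
Qed.

Lemma private_undominated_triangle_free a1 a2 d :
    private u v a1 -> private u v a2 -> undominated u v d ->
  adj a1 d -> adj a2 d -> ~~ adj a1 a2.
Proof.
move=> /andP[_ va1] /andP[_ va2] /andP[_ vd] a1d a2d; apply/negP=> a12.
by apply: (@no_K3K1 a1 a2 d v); adj_done.
Qed.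

Lemma common_undominated x d :
  adj u x -> adj v x -> undominated u v d -> adj x d.
Proof.
move=> ux vx /andP[ud vd]; apply: contraT => xd; exfalso.
by apply: (@no_K3K1 u v x d); adj_done.
Qed.

(* The robber at [d] may only flee to a private neighbour [a'] of [u], and is
   then caught by the cops at [a] and [u]. *)
Lemma win_private a d :
    undominated u v d -> private u v a -> adj a d ->
    (forall a' y, private u v a' -> adj a' d -> ~~ adj a a' ->
       adj a' y -> ~~ adj u y -> adj a y) ->
  win 2 u v d.
Proof.
move=> /andP[ud vd] /andP[ua va] ad aP.
apply: (@win_move _ _ _ _ _ a v); rewrite ?stepxx /step ?ua ?orbT // => a' dr.
have [C|] := boolP (step a a' || step v a'); first exact: win_capture.
rewrite /step !negb_or -!andbA => /and4P[nra ara nrv vra].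
have a'd : adj a' d.
  by case/orP: dr nra ara => [/eqP<-|]; [rewrite ad|rewrite adj_sym].
have [ua'|ua'] := boolP (adj u a'); last first.
  have J' : undominated u v a' by rewrite /undominated ua' vra.
  have J : undominated u v d by rewrite /undominated ud vd.
  have A : private u v a by rewrite /private ua va.
  by have := private_undominated_isolated A J J' ad; rewrite adj_sym a'd.
have A' : private u v a' by rewrite /private ua' vra.
apply: (@win_move _ _ _ _ _ a u); rewrite ?stepxx // /step.
  by rewrite adj_sym uv orbT.
move=> y; have [uy _|uy] := boolP (adj u y).
  by apply: win_capture; rewrite /step uy !orbT.
case/orP=> [/eqP a'y|a'y]; first by rewrite a'y in ua'; rewrite ua' in uy.
by apply: win_capture; rewrite /step (aP _ _ A' a'd ara a'y uy) orbT.
Qed.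

Definition covers (a : G) := [forall e, undominated u v e ==> adj a e].

Lemma coversP a :
  reflect (forall e, undominated u v e -> adj a e) (covers a).
Proof. exact: 'forall_implyP. Qed.

End Edge.

(** The robber, attacked at [d] from [a], escapes through [a'] to [b]. For an edge [u v], adjacency
    of [a'] and [b] follows from the clauses. *)
Definition obstruction u v d a' a b :=
  [/\ private u v a', adj a' d, ~~ covers u v a' &
   [/\ private u v a, covers u v a, private v u b, covers u v b &
     ~~ adj a b]].

(** * Attacks on an undominated vertex and their obstructions *)

Section Obstruction.

Variables u v : G.
Hypothesis uv : adj u v.

Let vu : adj v u. Proof. by rewrite adj_sym. Qed.

Lemma private_nonadj a b d :
    private u v a -> private v u b -> ~~ adj a b -> undominated u v d ->
  adj a d = adj b d.
Proof.
move=> A B ab J; apply/idP/idP; last exact: (private_nonadj_sub uv A B).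
by apply: (private_nonadj_sub vu B A); rewrite 1?adj_sym 1?undominatedC.
Qed.

(** If some private neighbour of [u] covers, attack from a covering one with the most neighbours
    private to [v]; otherwise attack from one adjacent to [d] with the most undominated
    neighbours. *)
Lemma win_or_obstruction a0 d :
    undominated u v d -> private u v a0 -> adj a0 d ->
  win 2 u v d \/ exists a' a b, obstruction u v d a' a b.
Proof.
move=> Jd A0 a0d.
have notU y : ~~ adj u y -> ~~ undominated u v y -> private v u y.
  by move=> uy; rewrite /undominated /private uy andbT negbK.
have [/existsP[a1 /andP[A1 D1]]|noD] :=
    boolP [exists a, private u v a && covers u v a].
  pose P a := private u v a && covers u v a.
  have P1 : P a1 by rewrite /P A1.
  pose F a := #|[set y | private v u y & adj a y]|.
  case: (@arg_maxnP _ a1 P F P1) => a /andP[A /coversP D] maxa.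
  have ad := D d Jd.
  (* A bad pair is an escape: the robber flees to [p.1] and then to [p.2], out of reach of cops on
     [a] and [u]. *)
  have [/existsP[p]|good] := boolP [exists p : G * G, [&& private u v p.1,
      adj p.1 d, ~~ adj a p.1, adj p.1 p.2, ~~ adj u p.2 & ~~ adj a p.2]].
    case: p => a' y /= /and5P[A' a'd aa' a'y /andP[uy ay]]; right.
    have B : private v u y.
      by apply: notU => //; apply: contraNN ay; exact: D.
    have Dy : covers u v y.
      by apply/coversP=> e Je; rewrite -(private_nonadj A B ay Je) D.
    exists a', a, y; split=> //; last by split=> //; apply/coversP.
    (* If [a'] covered too, maximality of [a] would give a [z] private to [v], seen by [a] but not
       by [a'], and [y a' u a z] would be an induced path. *)
    apply/negP=> D'; have := maxa a'; rewrite /P A' D' => /(_ isT).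
    apply/negP; rewrite -ltnNge; apply: proper_card.
    apply/properP; split; last by exists y; rewrite !inE B.
    apply/subsetP=> z; rewrite !inE => /andP[Bz az]; rewrite Bz /=.
    apply: contraT => a'z; exfalso.
    have zd : adj z d by rewrite -(private_nonadj A' Bz a'z Jd).
    have yd : adj y d by have/coversP := Dy; apply.
    have yz : ~~ adj y z.
      apply: (private_undominated_triangle_free (d := d) B Bz) => //.
      by rewrite undominatedC.
    case/andP: A A' B Bz => ua _ /andP[ua' _] _ /andP[_ uz].
    by apply: (@no_P5 y a' u a z); adj_done.
  left; apply: (win_private uv Jd A ad) => a' y A' a'd aa' a'y uy.
  apply: contraNT good => ay; apply/existsP; exists (a', y).
  by rewrite /= A' a'd aa' a'y uy ay.
left; pose P a := private u v a && adj a d.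
have P0 : P a0 by rewrite /P A0.
pose F a := #|[set e | undominated u v e & adj a e]|.
case: (@arg_maxnP _ a0 P F P0) => a /andP[A ad] maxa.
apply: (win_private uv Jd A ad) => a' y A' a'd aa' a'y uy.
(* By [private_chain], a counterexample [e] would put the undominated neighbours of [a] strictly
   inside those of [a'], against maximality. *)
have sub e : undominated u v e -> adj a' e -> adj a e.
  move=> Je a'e; apply: contraT => ae.
  have := maxa a'; rewrite /P A' a'd => /(_ isT).
  apply: contraLR => _; rewrite -ltnNge; apply: proper_card.
  apply/properP; split; last by exists e; rewrite !inE Je.
  apply/subsetP=> f; rewrite !inE => /andP[Jf af]; rewrite Jf /=.
  by apply: (private_chain uv A' A _ Je Jf); adj_done.
have [/sub|Jy] := boolP (undominated u v y); first exact.
have B := notU y uy Jy.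
(* If [a] misses [y], then [a] covers: an [e] missed by [a] is also missed by [y], [a'] and [d],
   which form a triangle. *)
apply: contraT => ay; case/negP: noD; apply/existsP; exists a; rewrite A /=.
apply/coversP=> e Je.
have yd : adj y d by rewrite -(private_nonadj A B ay Jd).
rewrite (private_nonadj A B ay Je).
apply: contraT => ye.
have a'e : ~~ adj a' e.
  by apply: contraNN ye => /(sub _ Je); rewrite (private_nonadj A B ay Je).
have de := private_undominated_isolated uv A' Jd Je a'd.
by exfalso; apply: (@no_K3K1 a' y d e); adj_done.
Qed.

End Obstruction.

Lemma coversC u v a : covers u v a = covers v u a.
Proof. by apply: eq_forallb => e; rewrite undominatedC. Qed.

(* The edge [a' b'] dominates all vertices but some common neighbours of [u]
   and [v]; a robber there is caught by the cops moving to [a] and [u]. *)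
Lemma two_obstructions_win u v d a' a b b' a2 b2 :
    adj u v -> undominated u v d ->
    obstruction u v d a' a b -> obstruction v u d b' b2 a2 ->
  forall r, win 2 a' b' r.
Proof.
move=> uv Jd [A' a'd D' [A D B Db ab]] [B' b'd D'' _] r.
have vu : adj v u by rewrite adj_sym.
have Jd' : undominated v u d by rewrite undominatedC.
have ad : adj a d by have /coversP := D; apply.
have bd : adj b d by have /coversP := Db; apply.
have [e' Je' a'e'] : exists2 e, undominated u v e & ~~ adj a' e.
  by case/forallPn: D' => e; rewrite negb_imply => /andP[]; exists e.
have [e'' Je'' b'e''] : exists2 e, undominated u v e & ~~ adj b' e.
  case/forallPn: D'' => e; rewrite negb_imply undominatedC => /andP[].
  by exists e.
(* Non-adjacent [a'] and [y] would have the same undominated neighbours, but only [y] sees [e']. *)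
have a'B y : private v u y -> covers u v y -> adj a' y.
  move=> By /coversP Dy; apply: contraNT a'e' => a'y.
  by rewrite (private_nonadj uv A' By a'y Je') Dy.
have b'A y : private u v y -> covers u v y -> adj y b'.
  move=> Ay /coversP Dy; apply: contraNT b'e'' => b'y.
  by rewrite -(private_nonadj uv Ay B' b'y Je'') Dy.
have a'b := a'B b B Db.
have ab' := b'A a A D.
have aa' := private_undominated_triangle_free A A' Jd ad a'd.
have bb' := private_undominated_triangle_free B B' Jd' bd b'd.
case/andP: (A) (A') (B) (B') => ua va /andP[ua' va'] /andP[vb ub] /andP[vb' ub'].
(* Otherwise [b a' u a b'] is an induced path. *)
have a'b' : adj a' b'.
  by apply: contraT => n; exfalso; apply: (@no_P5 b a' u a b'); adj_done.
have cover e : undominated u v e -> adj a' e || adj b' e.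
  move=> Je; apply: contraT; rewrite negb_or => /andP[a'e b'e]; exfalso.
  have de := private_undominated_isolated uv A' Jd Je a'd.
  by apply: (@no_K3K1 a' b' d e); adj_done.
have [C|] := boolP (step a' r || step b' r); first exact: win_capture.
rewrite /step !negb_or -!andbA => /and4P[a'r0 a'r b'r0 b'r].
(* Otherwise [r] is private to [v] and sees the same undominated vertices as [a']. Then [b'] sees
   [e'] but not [e''], and [r] the reverse, against [private_chain]. *)
have ur : adj u r.
  apply: contraT => ur; exfalso.
  have vr : adj v r.
    apply: contraT => vr; have := cover r.
    by rewrite /undominated ur vr (negbTE a'r) (negbTE b'r) => /(_ isT).
  have Br : private v u r by rewrite /private vr ur.
  have Ee e : undominated u v e -> adj a' e = adj r e.
    by apply: private_nonadj.
  have re'' : adj r e''.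
    by rewrite -Ee //; have := cover _ Je''; rewrite (negbTE b'e'') orbF.
  have re' : ~~ adj r e' by rewrite -Ee.
  have b'e' : adj b' e' by have := cover _ Je'; rewrite (negbTE a'e').
  have := @private_chain v u vu b' r e' e'' B' Br b'r.
  rewrite !(undominatedC v u) => /(_ Je' Je'' b'e' re' re'').
  by apply/negP.
have vr : adj v r.
  apply: contraT => vr; exfalso.
  have Ar : private u v r by rewrite /private ur vr.
  have Ee e : undominated u v e -> adj r e = adj b' e.
    by apply: (private_nonadj uv Ar B'); rewrite adj_sym.
  have re' : adj r e'.
    by rewrite Ee //; have := cover _ Je'; rewrite (negbTE a'e').
  have re'' : ~~ adj r e'' by rewrite Ee.
  have a'e'' : adj a' e''.
    by have := cover _ Je''; rewrite (negbTE b'e'') orbF.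
  have := @private_chain u v uv a' r e'' e' A' Ar a'r Je'' Je' a'e'' re'' re'.
  by apply/negP.
have ar : ~~ adj a r.
  apply/negP=> ar.
  have re' := common_undominated uv ur vr Je'.
  have ae' : adj a e' by have /coversP := D; apply.
  by apply: (@no_K3K1 a r e' a'); adj_done.
apply: (@win_move _ _ _ _ _ u a).
- by rewrite /step adj_sym ua' orbT.
- by rewrite /step adj_sym ab' orbT.
move=> y; have [uy _|uy] := boolP (adj u y).
  by apply: win_capture; rewrite /step uy !orbT.
case/orP=> [/eqP ry|ry]; first by rewrite ry (negbTE uy) in ur.
apply: win_capture; rewrite /step; suff -> : adj a y by rewrite !orbT.
(* As [a] covers, a [y] missed by [u] and [a] is adjacent to [v], and the triangle [v r y] misses
   [a]. *)
apply: contraT => ay; exfalso.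
have vy : adj v y.
  apply: contraT => vy; case/negP: ay.
  by have /coversP := D; apply; rewrite /undominated uy vy.
by apply: (@no_K3K1 v r y a); adj_done.
Qed.

(** By [common_undominated], cops on [x] and [v] leave only private neighbours of [u] unguarded, and
    the robber cannot reach those from [d]. *)
Lemma win_common u v d x :
    adj u v -> undominated u v d -> adj u x -> adj v x ->
    (forall a, private u v a -> ~~ adj a d) ->
  win 2 u v d.
Proof.
move=> uv Jd ux vx noA; apply: (@win_move _ _ _ _ _ x v).
- by rewrite /step ux orbT.
- by rewrite stepxx.
move=> r dr; apply: win_capture; rewrite /step.
have [vr|vr] := boolP (adj v r); first by rewrite !orbT.
suff -> : adj x r by rewrite orbT.
case/orP: dr => [/eqP<-|dr]; first exact: common_undominated vx Jd.
have [ur|ur] := boolP (adj u r); last first.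
  by apply: (common_undominated uv); rewrite /undominated ?ur.
by have := noA r; rewrite /private ur vr adj_sym dr => /(_ isT).
Qed.

(** * Edges of maximum coverage in a connected graph *)

Hypothesis connG : forall (P : pred G) x y,
  P x -> (forall w z, P w -> adj w z -> P z) -> P y.

(** On an edge this counts all dominated vertices, as each end is a neighbour of the other. *)
Definition coverage (p : G * G) := #|[set z | adj p.1 z || adj p.2 z]|.

Lemma private_neighbor u v d :
    adj u v -> (forall w z, adj w z -> coverage (w, z) <= coverage (u, v)) ->
    (forall x, adj u x -> ~~ adj v x) -> undominated u v d ->
  exists2 a, private u v a & adj a d.
Proof.
move=> uv maxuv noX Jd; have vu : adj v u by rewrite adj_sym.
case: (pickP (fun a => private u v a && adj a d)) => [a /andP[]|noA].
  by exists a.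
exfalso.
(* Such a [b] sees every private neighbour of [u], by [private_nonadj_sub], so the edge [v b] would
   dominate more than [u v]. *)
have [/existsP[b /andP[Bb bd]]|noB] :=
    boolP [exists b, private v u b && adj b d].
  case/andP: (Bb) => vb ub; case/andP: (Jd) => ud vd.
  have := maxuv v b vb; apply/negP; rewrite -ltnNge; apply: proper_card.
  apply/properP; split; last first.
    by exists d; rewrite !inE /= ?bd ?orbT // (negbTE ud) (negbTE vd).
  apply/subsetP=> z; rewrite !inE /= => /orP[uz|->//].
  have Az : private u v z by rewrite /private uz noX.
  apply: contraT; rewrite negb_or => /andP[_ bz].
  have zb : ~~ adj z b by rewrite adj_sym.
  by have := noA z; rewrite Az (private_nonadj_sub uv Az Bb zb Jd bd).
(* [P] holds at [d] and spreads along edges by [private_undominated_isolated], so connectedness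
   carries it to [u], which [v] dominates. *)
pose P w := undominated u v w && [forall z, adj w z ==> undominated u v z].
have dom z : ~~ undominated u v z -> private u v z || private v u z.
  rewrite negb_and !negbK /private; have [uz|uz] := boolP (adj u z).
    by rewrite noX.
  by rewrite andbT.
suff: P u by rewrite /P /undominated vu andbF.
apply: (@connG P d u) => [|w z /andP[Jw /forallP wP] wz].
  rewrite /P Jd; apply/forallP=> z; apply/implyP=> dz.
  apply: contraT => /dom/orP[Az|Bz].
    by have := noA z; rewrite Az adj_sym dz.
  by case/negP: noB; apply/existsP; exists z; rewrite Bz adj_sym dz.
have Jz : undominated u v z by have /implyP := wP z; apply.
rewrite /P Jz; apply/forallP=> t; apply/implyP=> zt.
apply: contraT => /dom/orP[At|Bt].
  have := private_undominated_isolated uv At Jz Jw.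
  by rewrite adj_sym zt adj_sym wz => /(_ isT).
have := @private_undominated_isolated v u vu t z w Bt.
rewrite !(undominatedC v u) adj_sym zt adj_sym wz.
by move=> /(_ Jz Jw isT).
Qed.

Lemma win_edge u v d :
    adj u v -> (forall w z, adj w z -> coverage (w, z) <= coverage (u, v)) ->
    undominated u v d ->
  win 2 u v d \/ exists a' a b, obstruction u v d a' a b.
Proof.
move=> uv maxuv Jd.
case: (pickP (fun a => private u v a && adj a d)) => [a /andP[A ad]|noA].
  exact: win_or_obstruction A ad.
case: (pickP (fun x => adj u x && adj v x)) => [x /andP[ux vx]|noX].
  left; apply: (win_common uv Jd ux vx) => a A.
  by have := noA a; rewrite A => /= ->.
have [x ux|a A ad] := private_neighbor uv maxuv _ Jd.
  by have := noX x; rewrite ux => /= ->.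
by have := noA a; rewrite A ad.
Qed.

Lemma exists_win (x0 : G) : exists c1 c2 : G, forall r, win 2 c1 c2 r.
Proof.
case: (pickP (fun p : G * G => adj p.1 p.2)) => [p0 adj0|noE]; last first.
  exists x0, x0 => r; apply: win_capture.
  suff /eqP-> : r == x0 by rewrite stepxx.
  apply: (@connG (fun r => r == x0) x0) => // w z _ wz.
  by have := noE (w, z); rewrite /= wz.
case: (@arg_maxnP _ p0 (fun p => adj p.1 p.2) coverage adj0) => [[u v] /= uv].
move=> max; have maxuv w z : adj w z -> coverage (w, z) <= coverage (u, v).
  exact: (max (w, z)).
have vu : adj v u by rewrite adj_sym.
have maxvu w z : adj w z -> coverage (w, z) <= coverage (v, u).
  move=> wz; suff -> : coverage (v, u) = coverage (u, v) by exact: maxuv.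
  by apply: eq_card => y; rewrite !inE orbC.
have [/forallP w|/forallPn[d Nd]] := boolP [forall d, win 2 u v d].
  by exists u, v.
have Jd : undominated u v d.
  apply: contraNT Nd; rewrite negb_and !negbK => ud; apply: win_capture.
  by case/orP: ud => uvd; rewrite /step uvd !orbT.
have [W|[a' [a [b O1]]]] := win_edge uv maxuv Jd; first by rewrite W in Nd.
have [|W|[b' [b2 [a2 O2]]]] := win_edge vu maxvu (d := d).
- by rewrite undominatedC.
- by rewrite winC W in Nd.
by exists a', b'; exact: two_obstructions_win O1 O2.
Qed.

End Domination.

(** * From induced subgraphs and components to adjacency conditions *)

Section Embedding.

Variables H G : sgraph.

Lemma embedding_not_free (f : H -> G) :
    injective f -> (forall x y, adj (f x) (f y) = adj x y) ->
  ~ graph_free H G.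
Proof.
move=> f_inj f_adj /(_ (f @: [set: H])); apply.
have fS x : f x \in f @: [set: H] by rewrite imset_f.
pose h x : induced_subgraph (f @: [set: H]) := Sub (f x) (fS x).
have h_inj : injective h by move=> x y /(congr1 val)/f_inj.
have [|g hK gK] := inj_card_bij h_inj.
  by rewrite card_sig (card_imset _ f_inj) cardsT.
exists g => [|x y]; first by exists h.
by rewrite -f_adj -[in RHS](gK x) -[in RHS](gK y).
Qed.

(** Distinctness of the images need not be checked separately when [H] has no two vertices with
    equal neighbourhoods. *)
Lemma adj_preserving_inj (f : H -> G) :
    (forall x y : H, adj x =1 adj y -> x = y) ->
    (forall x y, adj (f x) (f y) = adj x y) ->
  injective f.
Proof.
by move=> twin_free f_adj x y fxy; apply: twin_free => z; rewrite -!f_adj fxy.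
Qed.

End Embedding.

Lemma path5_twin_free (x y : path_graph 5) : adj x =1 adj y -> x = y.
Proof.
move=> E; have E0 := E (@Ordinal 5 0 isT); have E1 := E (@Ordinal 5 1 isT).
have E2 := E (@Ordinal 5 2 isT); have E3 := E (@Ordinal 5 3 isT).
have {E}E4 := E (@Ordinal 5 4 isT); apply: val_inj.
case: x y E0 E1 E2 E3 E4 => [[|[|[|[|[|//]]]]] ?] [[|[|[|[|[|//]]]]] ?];
by [].
Qed.

Lemma P5_free_adj (G : sgraph) : graph_free (path_graph 5) G ->
  forall p q r s t : G,
  adj p q -> adj q r -> adj r s -> adj s t ->
  ~~ adj p r -> ~~ adj p s -> ~~ adj p t -> ~~ adj q s -> ~~ adj q t ->
  ~~ adj r t -> False.
Proof.
move=> free p q r s t pq qr rs st /negbTE pr /negbTE ps /negbTE pt /negbTE qs.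
move=> /negbTE qt /negbTE rt.
pose f (i : path_graph 5) := nth p [:: p; q; r; s; t] (val i).
have f_adj x y : adj (f x) (f y) = adj x y.
  case: x y => [[|[|[|[|[|//]]]]] ?] [[|[|[|[|[|//]]]]] ?];
  by rewrite /f /= ?adj_irrefl ?pq ?qr ?rs ?st ?pr ?ps ?pt ?qs ?qt ?rt //
    adj_sym ?pq ?qr ?rs ?st ?pr ?ps ?pt ?qs ?qt ?rt.
apply: (embedding_not_free _ f_adj free).
exact: adj_preserving_inj path5_twin_free f_adj.
Qed.

Lemma K3K1_twin_free (x y : union_graph (complete_graph 3) (complete_graph 1)) :
  adj x =1 adj y -> x = y.
Proof.
move=> E; have E0 := E (inl (@Ordinal 3 0 isT)).
have E1 := E (inl (@Ordinal 3 1 isT)); have {E}E2 := E (inl (@Ordinal 3 2 isT)).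
case: x y E0 E1 E2 => [[[|[|[|//]]] ?]|[[|//] ?]] [[[|[|[|//]]] ?]|[[|//] ?]];
by rewrite //= => _ _ _; congr (_ _); apply: val_inj.
Qed.

Lemma K3K1_free_adj (G : sgraph) :
    graph_free (union_graph (complete_graph 3) (complete_graph 1)) G ->
  forall p q r s : G,
  adj p q -> adj q r -> adj p r -> ~~ adj p s -> ~~ adj q s -> ~~ adj r s ->
  False.
Proof.
move=> free p q r s pq qr pr /negbTE ps /negbTE qs /negbTE rs.
pose f (x : union_graph (complete_graph 3) (complete_graph 1)) :=
  match x with inl i => nth p [:: p; q; r] (val i) | inr _ => s end.
have f_adj x y : adj (f x) (f y) = adj x y.
  case: x y => [[[|[|[|//]]] ?]|[[|//] ?]] [[[|[|[|//]]] ?]|[[|//] ?]];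
  by rewrite /f /= ?adj_irrefl ?pq ?qr ?pr ?ps ?qs ?rs //
    adj_sym ?pq ?qr ?pr ?ps ?qs ?rs.
apply: (embedding_not_free _ f_adj free).
exact: adj_preserving_inj K3K1_twin_free f_adj.
Qed.

(** A path of [G] lifts to the component, which contains every vertex. *)
Lemma component_closed (G : sgraph) (x : G) :
    graph_connected G -> forall (P : pred (component x)) y z,
  P y -> (forall w t, P w -> adj w t -> P t) -> P z.
Proof.
move=> Gconn P y z Py Pcl; have /connectP[p] := Gconn (val y) (val z).
elim: p y Py => [|t p IHp] y Py /= => [_ /val_inj->//|/andP[yt tp] zE].
have tS : t \in [set y | connect adj x y] by rewrite inE Gconn.
by apply: (IHp (Sub t tS)) => //; apply: Pcl Py _.
Qed.

Theorem theorem4p1 (G : sgraph) (Gconn : graph_connected G)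
  (P5_free : graph_free (path_graph 5) G)
  (K3K1_free : graph_free (union_graph (complete_graph 3) (complete_graph 1)) G) :
  cop_number G <= 2.
Proof.
rewrite /cop_number; case: ex_minnP => m _; apply; apply/asboolP=> x.
have xS : x \in [set y | connect adj x y] by rewrite inE connect0.
have [||c1 [c2 w]] := @exists_win (component x) _ _ (component_closed Gconn)
  (Sub x xS).
- move=> p q r s t.
  exact: (P5_free_adj P5_free (p := val p) (q := val q) (r := val r)).
- move=> p q r s.
  exact: (K3K1_free_adj K3K1_free (p := val p) (q := val q)).
exact: cops_win_of_win w.
Qed.
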